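(* Let $c<1$, let $(m_n)_{n\ge 2}$ be a sequence of positive integers, write $m=m_n$ and $p=p_n:=n^{-2}$, and for each $n$ let $X=(X_{ij})_{1\le i,j\le n}$ be a random matrix with joint multinomial distribution $\mathcal{M}(m,n^2)$. Assume that $$\limsup_{n\to\infty}\frac{mp}{\log n}\le c.$$ Then $$\lim_{n\to\infty}\mathbb{P}\left(\min_{\sigma\in\mathcal{S}_n}\sum_{i=1}^n X_{i\sigma(i)}=0\right)=1.$$
   Context: $\mathcal{S}_n$ denotes the group of permutations of $\{1,\dots,n\}$. $\mathcal{M}(m,N)$ denotes the multinomial law with $m$ trials and $N$ equiprobable cells: it is the law of the vector of cell counts when $m$ particles are thrown independently and uniformly into $N$ cells. Under $\mathcal{M}(m,n^2)$ the cells are the $n^2$ positions $(i,j)$ of the matrix, so each $X_{ij}$ has the binomial distribution with $m$ trials and success probability $p=n^{-2}$, and $\sum_{i,j}X_{ij}=m$. *)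

(* Defs.v *)
From mathcomp Require Import all_boot all_order all_algebra all_fingroup.
From mathcomp Require Import all_classical all_reals all_analysis.

Set Implicit Arguments.
Unset Strict Implicit.
Unset Printing Implicit Defensive.
Import Order.TTheory GRing.Theory Num.Theory.
Import numFieldNormedType.Exports.

Local Open Scope classical_set_scope.
Local Open Scope ring_scope.

(* A throw [f] sends each of the m particles to one of the cells in I. *)
Definition cell_count (I : finType) (m : nat) (f : {ffun 'I_m -> I}) (x : I)
    : nat := #|[set t | f t == x]%SET|.

(* Mass given to the count vector k by the multinomial law with m trials and
   #|I| equiprobable cells: all #|I| ^ m throws are equally likely. *)
Definition multinomial_pmf (R : realType) (I : finType) (m : nat)
    (k : I -> nat) : R :=
  #|[set f : {ffun 'I_m -> I} | [forall x, cell_count f x == k x]]%SET|%:R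
    / (#|I| ^ m)%N%:R.

(* Joint law of the whole family of counts, which takes its values in the
   countable set of maps I -> nat and so is determined by its point masses. *)
Definition has_multinomial_law (R : realType) (d : measure_display)
    (T : measurableType d) (P : probability T R) (I : finType)
    (X : I -> {RV P >-> nat}) (m : nat) : Prop :=
  forall k : I -> nat,
    P [set w | forall x, X x w = k x] = (multinomial_pmf R m k)%:E.

(* The initial value of the minimum is the term of the identity permutation,
   so that this is the minimum over the nonempty set 'S_n. *)
Definition min_assignment (n : nat) (A : 'I_n -> 'I_n -> nat) : nat :=
  \big[minn/(\sum_(i < n) A i i)%N]_(s : 'S_n) (\sum_(i < n) A i (s i))%N.

(* Main.v *)
Require Import Defs.
From mathcomp Require Import all_boot all_order all_algebra all_fingroup.
From mathcomp Require Import zify ring lra.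

(** The minimum vanishes exactly when the empty cells contain the graph of a
permutation, that is, when the bipartite graph of the empty cells has a perfect
matching. By Hall's theorem ([hall_marriage]) the only obstruction is a block
[A * B] of occupied cells with [#|A| + #|B| > n]
([no_matching_block]).

Let [p = 1 / n ^ 2] and let [q = (1 - p) ^ m] be the probability that a given
cell is empty. Occupied cells are negatively correlated, so that a block of
area [a] is fully occupied with probability at most [(1 - q) ^ a]
([card_hitting_le]), which is at most [expR (- q a)]. A block with sides adding
up to more than [n] has area at least [n / 4] times the size of one side plus
that of the complement of the other; therefore the sum of these bounds over
all blocks is at most [2 ((1 + z) ^ (2 n) - 1)], where [z = expR (- q n / 4)]
([sum_blocks_le]).

When [m p] is at most [(1 - 2 eps) ln n], the expected number [n q] of empty
cells in a row is at least [n ^ eps] ([expected_empty_row_ge]). It dominates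
[ln n], so that [z] is at most [n ^ (-2)] and the sum above is
at most [2 (expR (2 / n) - 1)], which tends to 0 ([no_matching_le]). The
crude union bound is enough because the exponent [n q] is a positive power of
[n] for every [c < 1], whereas the number of blocks costs only multiples of
[ln n] in the exponent.

The counting takes place among the equally likely throws of [m] particles, and
[le_law_count] carries it over to the random matrix. *)

Set Implicit Arguments.
Unset Strict Implicit.
Unset Printing Implicit Defensive.
Import Order.TTheory GRing.Theory Num.Theory.

Local Open Scope ring_scope.

(** * Hall's marriage theorem *)

Section Hall.
Variables (T U : finType).
Implicit Types (F : T -> {set U}) (A : {set T}).

Definition neighbours F A : {set U} := (\bigcup_(t in A) F t).

Definition hall_condition F := [forall A : {set T}, #|A| <= #|neighbours F A|]%N.

Definition delete_edge F t x : T -> {set U} :=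
  fun s => if s == t then F t :\ x else F s.

Lemma neighboursU F A B : neighbours F (A :|: B) = (neighbours F A :|: neighbours F B).
Proof. by rewrite /neighbours bigcup_setU. Qed.

Lemma neighboursI F A B :
  neighbours F (A :&: B) \subset (neighbours F A :&: neighbours F B).
Proof.
by rewrite subsetI; apply/andP; split; apply/bigcupsP=> t /setIP[tA tB];
   apply: bigcup_sup.
Qed.

Lemma neighbours_delete_out F A t x : t \notin A ->
  neighbours (delete_edge F t x) A = neighbours F A.
Proof.
move=> tA; apply: eq_bigr => s sA; rewrite /delete_edge ifN //.
by apply: contraNneq tA => <-.
Qed.

Lemma neighbours_deleteU1 F A t x : t \notin A ->
  neighbours (delete_edge F t x) (t |: A) = (F t :\ x :|: neighbours F A).
Proof.
move=> tA; rewrite neighboursU (neighbours_delete_out F x tA).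
by rewrite /neighbours big_set1 /delete_edge eqxx.
Qed.

(** A set violating the condition once the edge from [t] to [x] is gone has to
contain [t]; the violation is recorded for the rest of that set. *)
Lemma delete_violator F t x :
  hall_condition F -> ~~ hall_condition (delete_edge F t x) ->
  exists2 A : {set T}, t \notin A & (#|(F t :\ x :|: neighbours F A)| <= #|A|)%N.
Proof.
move=> /forallP hF /forallPn[A]; rewrite -ltnNge => ltA.
have [tA|tA] := boolP (t \in A); last first.
  by rewrite neighbours_delete_out // ltnNge hF in ltA.
exists (A :\ t); first by rewrite !inE eqxx.
rewrite -neighbours_deleteU1 ?inE ?eqxx //.
by rewrite setD1K // -ltnS (leq_trans ltA) // (cardsD1 t A) tA.
Qed.

(** Rado's uncrossing argument. If neither edge could be deleted, there would
be violators [t |: A] and [t |: B], with neighbourhoods [P] and [Q] in the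
respective reduced graphs. Since
[x] and [y] differ, [P :|: Q] contains all the neighbours of
[t |: (A :|: B)], and [P :&: Q] contains those of [A :&: B]. Adding up the
two instances of the condition for [F] yields
[#|A| + #|B| + 1 <= #|P| + #|Q|], against the choice of [A] and [B]. *)
Lemma hall_condition_delete F t x y : hall_condition F -> x != y ->
  hall_condition (delete_edge F t x) \/ hall_condition (delete_edge F t y).
Proof.
move=> hF xy.
have [|nx] := boolP (hall_condition (delete_edge F t x)); first by left.
have [|ny] := boolP (hall_condition (delete_edge F t y)); first by right.
have [A tA hA] := delete_violator hF nx; have [B tB hB] := delete_violator hF ny.
set P := (_ :|: _) in hA; set Q := (_ :|: _) in hB.
have hU : neighbours F (t |: (A :|: B)) \subset P :|: Q.
  rewrite !neighboursU /neighbours big_set1 /P /Q; apply/subsetP => z.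
  rewrite !inE; have [->|] := eqVneq z x; last by move=> _ /or3P[]->; rewrite ?orbT.
  by rewrite xy /= => /or3P[]->; rewrite ?orbT.
have hI : neighbours F (A :&: B) \subset P :&: Q.
  apply: (subset_trans (neighboursI F A B)); apply/subsetP => z.
  by rewrite !inE => /andP[-> ->]; rewrite !orbT.
have := leq_trans (forallP hF _) (subset_leq_card hU).
have := leq_trans (forallP hF _) (subset_leq_card hI).
rewrite cardsU1 inE negb_or tA tB /=.
have := cardsUI P Q; have := cardsUI A B; lia.
Qed.

(** Deleting edges as long as some [F t] has two elements ends with a family of
singletons; on singletons the condition for pairs is injectivity. *)
Theorem hall_marriage F : hall_condition F ->
  exists2 f : T -> U, injective f & forall t, f t \in F t.
Proof.
have [k] := ubnP (\sum_t #|F t|)%N.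
elim: k F => // k IH F; rewrite ltnS => leF hF.
have F0 t : (0 < #|F t|)%N.
  by have := forallP hF [set t]; rewrite cards1 /neighbours big_set1.
have [/forallP h|/forallPn [t]] := boolP [forall t, #|F t| <= 1]%N.
  have F1 t : exists x, F t == [set x].
    suff /cards1P[x ->] : #|F t| == 1%N by exists x.
    by rewrite eqn_leq h F0.
  exists (fun t => xchoose (F1 t)) => [s t st|t]; last first.
    by rewrite {2}(eqP (xchooseP (F1 t))) inE.
  apply: contraTeq (forallP hF [set s; t]) => nst.
  rewrite cards2 nst neighboursU /neighbours !big_set1 (eqP (xchooseP (F1 s))).
  by rewrite (eqP (xchooseP (F1 t))) st setUid cards1.
rewrite -ltnNge => /card_gt1P [x [y [xF yF xy]]].
have [z zF hz] : exists2 z, z \in F t & hall_condition (delete_edge F t z).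
  by have [h|h] := hall_condition_delete t hF xy; [exists x|exists y].
have [|f fI fF] := IH (delete_edge F t z) _ hz.
  apply: leq_trans leF; rewrite (bigD1 t) //= [X in (_ < X)%N](bigD1 t) //=.
  rewrite /delete_edge eqxx (cardsD1 z (F t)) zF.
  by rewrite (eq_bigr (fun i => #|F i|)) // => i /negbTE ->.
exists f => // s; have := fF s; rewrite /delete_edge.
by case: eqP => // -> /setD1P[].
Qed.
End Hall.

(** * Probability of hitting a given set of cells *)

Definition hitting (I : finType) (m : nat) (S : {set I}) :
    {set {ffun 'I_m -> I}} :=
  [set f : {ffun 'I_m -> I} | S \subset codom f].

(** The first particle lands in some cell [x]; the others then have to hit all
that remains of [S]. *)
Lemma card_hittingS (I : finType) m (S : {set I}) :
  (#|hitting m.+1 S| <= \sum_x #|hitting m (S :\ x)|)%N.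
Proof.
rewrite -sum1_card (partition_big (fun f : {ffun 'I_m.+1 -> I} => f ord0) xpredT) //=.
apply: leq_sum => x _; rewrite sum1_card.
pose tl (f : {ffun 'I_m.+1 -> I}) : {ffun 'I_m -> I} := [ffun t => f (lift ord0 t)].
pose A := [pred f : {ffun 'I_m.+1 -> I} | (f \in hitting m.+1 S) && (f ord0 == x)].
rewrite -[leqLHS]/(#|A|) -(@card_in_imset _ _ tl A).
  apply/subset_leq_card/subsetP => g /imsetP[f]; rewrite !inE.
  move=> /andP[/subsetP hS /eqP fx] ->; apply/subsetP => y /setD1P[yx /hS].
  move=> /codomP[t yt]; apply/codomP; case: (unliftP ord0 t) => [t' tt|tt].
    by exists t'; rewrite ffunE yt tt.
  by rewrite yt tt fx eqxx in yx.
move=> f g /andP[_ /eqP f0] /andP[_ /eqP g0] fg; apply/ffunP => t.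
case: (unliftP ord0 t) => [t' ->|->]; last by rewrite f0.
by have /ffunP/(_ t') := fg; rewrite !ffunE.
Qed.

(** Bernoulli's inequality in homogeneous form, hence also valid at [u = 0]. *)
Lemma exprDn_ge (R : realFieldType) (u v : R) n : 0 <= u -> 0 <= v ->
  u ^+ n + n%:R * u ^+ n.-1 * v <= (u + v) ^+ n.
Proof.
move=> u0 v0; elim: n => [|[|n] IH]; rewrite ?expr0 ?mul0r ?addr0//.
  by rewrite ?expr1 ?mulr1 ?mul1r.
rewrite [in leRHS]exprS; apply: (le_trans _ (ler_wpM2l (addr_ge0 u0 v0) IH)).
rewrite -subr_ge0 /= (_ : _ - _ = n.+1%:R * u ^+ n * v ^+ 2).
  by rewrite !mulr_ge0 ?exprn_ge0.
rewrite -[n.+2%:R]natr1 !exprS; ring.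
Qed.

(** Negative correlation of the occupied cells: the cells of [S] are all hit
with at most the probability that they would have if they were hit
independently. By induction on [m]: with [u] the probability that a given
cell is hit by [m] particles and [p] the inverse of the number of cells,
conditioning on the first particle bounds the probability for [m.+1] by
[(1 - s p) u ^ s + s p u ^ (s - 1)], where [s] is the size of [S]. That is
the beginning of the binomial expansion of [(u + p (1 - u)) ^ s], whose base
is the probability that a given cell is hit by [m.+1] particles. *)
Lemma card_hitting_le (R : realFieldType) (I : finType) m (S : {set I}) :
  (0 < #|I|)%N ->
  #|hitting m S|%:R <=
    (#|I| ^ m)%:R * (1 - (1 - #|I|%:R^-1) ^+ m) ^+ #|S| :> R.
Proof.
move=> I0; elim: m S => [|m IH] S.
  rewrite subrr expr0n expn0 mul1r cards_eq0.
  have [->|/set0Pn[x xS]] := eqVneq.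
    by rewrite ler_nat (leq_trans (max_card _))// card_ffun card_ord expn0.
  rewrite (_ : hitting 0 S = set0) ?cards0//; apply/setP => f; rewrite !inE.
  apply/negP => /subsetP/(_ _ xS)/codomP[[]]; by [].
have := card_hittingS m S; rewrite -(ler_nat R) => /le_trans; apply.
rewrite natr_sum; apply: (le_trans (ler_sum _ (fun x _ => IH (S :\ x)))).
set p : R := #|I|%:R^-1; set u : R := 1 - (1 - p) ^+ m.
have p0 : 0 < p by rewrite invr_gt0 ltr0n.
have p1 : p <= 1 by rewrite invf_le1 ?ltr0n// ler1n.
have q01 : 0 <= (1 - p) ^+ m <= 1.
  by rewrite exprn_ge0 ?subr_ge0 // exprn_ile1 ?subr_ge0 // gerBl ltW.
have u0 : 0 <= u by rewrite subr_ge0; case/andP: q01.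
have -> : 1 - (1 - p) ^+ m.+1 = u + p * (1 - u) by rewrite /u exprS; ring.
have u1 : 0 <= 1 - u by rewrite /u subKr; case/andP: q01.
have Ip : #|I|%:R * p = 1 by rewrite divff// pnatr_eq0 -lt0n.
clearbody u; clearbody p.
rewrite -mulr_sumr expnSr natrM -mulrA ler_wpM2l //.
rewrite (bigID (mem S)) /= (eq_bigr (fun=> u ^+ #|S|.-1)); last first.
  by move=> x xS; rewrite (cardsD1 x S) xS.
rewrite [X in _ + X](eq_bigr (fun=> u ^+ #|S|)); last first.
  by move=> x xS; rewrite (cardsD1 x S) (negbTE xS).
rewrite !sumr_const.
have -> : #|[pred x | x \notin S]| = (#|I| - #|S|)%N.
  by rewrite -(cardC (mem S)) addKn; apply: eq_card.
have leS : (#|S| <= #|I|)%N by apply: max_card.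
have v0 : 0 <= p * (1 - u) by rewrite mulr_ge0 // ltW.
apply: (le_trans _ (ler_wpM2l (ler0n _ _) (exprDn_ge #|S| u0 v0))).
rewrite -[_ *+ #|S|]mulr_natl -[_ *+ (_ - _)]mulr_natl natrB // mulrDr.
have -> : #|I|%:R * (#|S|%:R * u ^+ #|S|.-1 * (p * (1 - u))) =
  #|I|%:R * p * (#|S|%:R * u ^+ #|S|.-1 * (1 - u)) by ring.
rewrite Ip mul1r; case: #|S| => [|k] /=; first by rewrite !mul0r expr0; lra.
by rewrite le_eqVlt; apply/orP; left; apply/eqP; rewrite exprS; ring.
Qed.

(** * Union bound over the occupied blocks *)

Lemma no_matching_block n (e : rel 'I_n) :
  ~~ [exists s : 'S_n, forall i, e i (s i)] ->
  exists A B : {set 'I_n}, (n < #|A| + #|B|)%N /\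
    forall i j, i \in A -> j \in B -> ~~ e i j.
Proof.
move=> nm; pose F i := [set j | e i j].
have : ~~ hall_condition F.
  apply: contra nm => /hall_marriage[f fI fF].
  apply/existsP; exists (perm fI); apply/forallP => i.
  by have := fF i; rewrite inE permE.
move=> /forallPn[A]; rewrite -ltnNge => ltA; exists A, (~: neighbours F A); split.
  by rewrite -(ltn_add2r #|~: neighbours F A|) cardsC card_ord in ltA.
move=> i j iA; rewrite inE; apply: contra => eij.
by apply/bigcupP; exists i; rewrite ?inE.
Qed.

Lemma sum_expr_card (R : comPzSemiRingType) (I : finType) (z : R) :
  \sum_(A : {set I}) z ^+ #|A| = (1 + z) ^+ #|I|.
Proof.
transitivity (\prod_(i : I) (z + 1)); last by rewrite prodr_const addrC.
rewrite bigA_distr /=; apply: eq_bigr => A _.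
by rewrite -big_mkcond prodr_const.
Qed.

(** The longer side of a block exceeds [n / 2], and the complement of the longer
side is smaller than the shorter side. So the area is at least [n / 4] times
the size of one of two pairs, consisting of the shorter side and the
complement of the longer one. *)
Lemma block_area_le n a b : (a <= n)%N -> (b <= n)%N -> (n < a + b)%N ->
  (n * (a + (n - b)) <= 4 * (a * b))%N \/ (n * ((n - a) + b) <= 4 * (a * b))%N.
Proof.
move=> an bn ab; case: (leqP a b) => h; [left|right].
  apply: (@leq_trans (2 * b * (2 * a))%N); last by nia.
  by apply: leq_mul; lia.
apply: (@leq_trans (2 * a * (2 * b))%N); last by nia.
by apply: leq_mul; lia.
Qed.

(** Each block is charged, through the preceding estimate, to a pair of sets
[(A, ~: B)] or [(~: A, B)] other than the pair of empty sets, with the weight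
[x ^+ n] for every element. The weights of all pairs of sets add up to
[(1 + x ^+ n) ^+ (n + n)], and the pair of empty sets accounts for 1. *)
Lemma sum_blocks_le (R : realFieldType) n (x : R) : 0 <= x <= 1 ->
  \sum_(p : {set 'I_n} * {set 'I_n} | (n < #|p.1| + #|p.2|)%N)
     x ^+ (4 * (#|p.1| * #|p.2|)) <= ((1 + x ^+ n) ^+ (n + n) - 1) *+ 2.
Proof.
case/andP => x0 x1; set z := x ^+ n.
have z0 : 0 <= z by rewrite exprn_ge0.
pose G (p : {set 'I_n} * {set 'I_n}) := z ^+ (#|p.1| + #|p.2|).
have sumG : \sum_(p | p != (set0, set0)) G p = (1 + z) ^+ (n + n) - 1.
  apply/eqP; rewrite eq_sym subr_eq eq_sym; apply/eqP.
  rewrite -[n in RHS]card_ord exprD -sum_expr_card big_distrlr /= pair_bigA /=.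
  rewrite [RHS](bigD1 (set0, set0)) //= !cards0 mul1r addrC; congr (_ + _).
  by apply: eq_bigr => p _; rewrite -exprD.
pose c1 (p : {set 'I_n} * {set 'I_n}) := (p.1, ~: p.2).
pose c2 (p : {set 'I_n} * {set 'I_n}) := (~: p.1, p.2).
have c1K : involutive c1 by case=> A B; rewrite /c1 /= setCK.
have c2K : involutive c2 by case=> A B; rewrite /c2 /= setCK.
rewrite mulr2n -{1}sumG -sumG [X in _ <= X + _](reindex_inj (inv_inj c1K)).
rewrite [X in _ <= _ + X](reindex_inj (inv_inj c2K)) /=.
rewrite !(big_mkcond (fun p => _ != _)) -big_split big_mkcond /=.
apply: ler_sum => -[A B] _; rewrite /c1 /c2 /G /=.
have Ggt0 k : 0 <= z ^+ k by rewrite exprn_ge0.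
case: ifP => [ltn|_]; last by rewrite addr_ge0 //; case: ifP.
have hA : (#|A| <= n)%N by rewrite -[leqRHS]card_ord max_card.
have hB : (#|B| <= n)%N by rewrite -[leqRHS]card_ord max_card.
have -> : (A, ~: B) != (set0, set0).
  by apply/eqP => -[A0 _]; rewrite A0 cards0 add0n ltnNge hB in ltn.
have -> : (~: A, B) != (set0, set0).
  by apply/eqP => -[_ B0]; rewrite B0 cards0 addn0 ltnNge hA in ltn.
rewrite (cardsCs (~: A)) (cardsCs (~: B)) !setCK card_ord /z -!exprM.
have [h|h] := block_area_le hA hB ltn; [apply: ler_wpDr|apply: ler_wpDl];
  rewrite ?exprn_ge0 //; exact: ler_wiXn2l.
Qed.

(** Union bound over the fully occupied blocks. The area estimate costs a factor
4 in the exponent, so that the probability of hitting a cell is compared with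
a fourth power. *)
Lemma card_no_matching_le (R : realFieldType) n m (x : R) : (0 < n)%N ->
  0 <= x <= 1 -> 1 - (1 - (n * n)%:R^-1) ^+ m <= x ^+ 4 ->
  #|[set f : {ffun 'I_m -> 'I_n * 'I_n} |
      ~~ [exists s : 'S_n, forall i, (i, s i) \notin codom f]]|%:R <=
    ((n * n) ^ m)%:R * (((1 + x ^+ n) ^+ (n + n) - 1) *+ 2).
Proof.
move=> n0 x01 hx; set D := [set f | _].
have card2 : #|{: 'I_n * 'I_n}| = (n * n)%N by rewrite card_prod card_ord.
pose Q := [pred p : {set 'I_n} * {set 'I_n} | (n < #|p.1| + #|p.2|)%N].
have DQ : D \subset \bigcup_(p | Q p) hitting m (setX p.1 p.2).
  apply/subsetP => f; rewrite inE.
  move=> /(@no_matching_block _ (fun i j => (i, j) \notin codom f)).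
  move=> [A [B [ltn h]]]; apply/bigcupP; exists (A, B) => //.
  rewrite inE; apply/subsetP => -[i j] /setXP[iA jB].
  by have := h i j iA jB; rewrite negbK.
have leD : (#|D| <= \sum_(p | Q p) #|hitting m (setX p.1 p.2)|)%N.
  apply: (leq_trans (subset_leq_card DQ)).
  elim/big_rec2 : _ => [|p a b _ ab]; first by rewrite cards0.
  by rewrite (leq_trans (leq_card_setU _ _)) // leq_add2l.
have u0 : 0 <= 1 - (1 - (n * n)%:R^-1) ^+ m :> R.
  have p1 : (n * n)%:R^-1 <= 1 :> R by rewrite invf_le1 ?ler1n ?ltr0n muln_gt0 n0.
  by rewrite subr_ge0 exprn_ile1 ?subr_ge0 // gerBl invr_ge0 ler0n.
rewrite -(ler_nat R) natr_sum in leD; apply: (le_trans leD).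
apply: (@le_trans _ _ (\sum_(p | Q p)
    ((n * n) ^ m)%:R * x ^+ (4 * (#|p.1| * #|p.2|)))); last first.
  by rewrite -mulr_sumr ler_wpM2l ?sum_blocks_le.
apply: ler_sum => p _; have := card_hitting_le R m (setX p.1 p.2).
rewrite card2 muln_gt0 n0 => /(_ isT)/le_trans; apply.
by rewrite ler_wpM2l // exprM cardsX lerXn2r // ?nnegrE ?exprn_ge0 //; case/andP: x01.
Qed.

From mathcomp Require Import all_classical all_reals all_analysis.
Import numFieldNormedType.Exports.

Local Open Scope classical_set_scope.

(** * Events that depend on the counts *)

Section Law.
Context (R : realType) (d : measure_display) (T : measurableType d)
  (P : probability T R) (I : finType) (X : I -> {RV P >-> nat}).

Let fiber (k : I -> nat) := [set w | forall x, X x w = k x].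

Lemma measurable_fiber k : measurable (fiber k).
Proof.
rewrite (_ : fiber k = \bigcap_(x in [set: I]) X x @^-1` [set k x]).
  apply: fin_bigcap_measurable => [|x _].
    exact: finite_finset.
  exact: measurable_funPTI.
by apply/seteqP; split => w /= h x; [move=> _|]; exact: h.
Qed.

(** The counts take their values in the countable set of maps from [I] to [nat],
so that every event that depends on them only is measurable. *)
Lemma measurable_RVs (Q : (I -> nat) -> Prop) :
  measurable [set w | Q (fun x => X x w)].
Proof.
rewrite (_ : [set w | _] =
  \bigcup_(k in [set k : {ffun I -> nat} | Q k]) fiber k).
  rewrite bigcup_mkcond; apply: countable_bigcupT_measurable => [|k].
    exact: countableP.
  by case: ifP => // _; exact: measurable_fiber.
apply/seteqP; split => w /=.
  move=> Qw; exists [ffun x => X x w]; last by move=> x; rewrite ffunE.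
  by rewrite /= (_ : (fun_of_fin _) = (fun x => X x w))//;
    apply/funext => x; rewrite ffunE.
by move=> [k /= Qk kw]; rewrite (_ : (fun x => _) = k)//; exact/funext.
Qed.

(** Under the multinomial law the counts behave as those of a uniformly chosen
throw. Summing over the finitely many count vectors bounded by [m] gives the
left-hand side; the vectors left out have probability 0, but an inequality spares
that verification. *)
Lemma le_law_count m (Q : pred (I -> nat)) : has_multinomial_law X m ->
  ((#|[set f : {ffun 'I_m -> I} | Q (cell_count f)]%SET|%:R / (#|I| ^ m)%:R)%:E
    <= P [set w | Q (fun x => X x w)])%E.
Proof.
move=> hX.
pose cnt (f : {ffun 'I_m -> I}) : {ffun I -> 'I_m.+1} :=
  [ffun x => inord (cell_count f x)].
pose K := [pred k : {ffun I -> 'I_m.+1} | Q (fun x => k x : nat)].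
have cntE f : (fun x => cnt f x : nat) = cell_count f.
  apply/funext => x; rewrite ffunE inordK// ltnS /cell_count.
  by rewrite -[leqRHS]card_ord max_card.
pose fk (k : {ffun I -> 'I_m.+1}) := fiber (fun x => k x : nat).
have <- : P (\bigcup_(k in [set k | K k]) fk k) =
    (#|[set f : {ffun 'I_m -> I} | Q (cell_count f)]%SET|%:R / (#|I| ^ m)%:R)%:E.
  rewrite measure_fin_bigcup//; last 3 first.
  - exact: finite_finset.
  - move=> k1 k2 _ _ [w [h1 h2]]; apply/ffunP => x; apply/val_inj => /=.
    by rewrite -(h1 x) -(h2 x).
  - by move=> k _; exact: measurable_fiber.
  rewrite (eq_fsbigr (fun k : {ffun I -> 'I_m.+1} =>
    (multinomial_pmf R m (fun x => k x : nat))%:E)); last first.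
    by move=> k _; exact: hX.
  rewrite (fsbigE (enum K)) ?enum_uniq//.
  - rewrite big_enum_cond /= (eq_bigl K); last first.
      by move=> k; rewrite mem_setE andbb.
    rewrite sumEFin -mulr_suml -natr_sum; congr (_%:R / _)%:E.
    rewrite -sum1_card (partition_big cnt K) /=; last first.
      by move=> f; rewrite inE cntE.
    apply: eq_bigr => k Kk; rewrite -sum1_card; apply: eq_bigl => f.
    rewrite !inE; apply/forallP/andP => [h|[_ /eqP <-] x].
      have ck : cnt f = k.
        by apply/ffunP => x; apply/val_inj; rewrite ffunE /= (eqP (h x)) inordK.
      by rewrite -cntE ck eqxx.
    by have /(congr1 (fun g => g x)) /= -> := cntE f.
  - by move=> k /=; rewrite mem_enum.
  - by move=> k /= Kk; rewrite mem_enum => /negP.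
rewrite le_measure ?inE//.
- apply: fin_bigcup_measurable => [|k _]; first exact: finite_finset.
  exact: measurable_fiber.
- exact: (measurable_RVs Q).
- move=> w [k /= Kk kw]; rewrite (_ : (fun x => _) = (fun x => k x : nat))//.
  exact/funext.
Qed.
End Law.

Lemma min_assignment_le n (A : 'I_n -> 'I_n -> nat) (s : 'S_n) :
  (min_assignment A <= \sum_(i < n) A i (s i))%N.
Proof.
rewrite /min_assignment.
have : s \in index_enum 'S_n by rewrite mem_index_enum.
elim: (index_enum _) => //= t r IH; rewrite inE big_cons geq_min.
by case/predU1P => [->|/IH ->]; rewrite ?leqnn ?orbT.
Qed.

Lemma min_assignment_eq0 n m (f : {ffun 'I_m -> 'I_n * 'I_n}) :
  [exists s : 'S_n, forall i, (i, s i) \notin codom f] ->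
  min_assignment (fun i j => cell_count f (i, j)) = 0%N.
Proof.
move=> /existsP[s /forallP sf]; apply/eqP; rewrite -leqn0.
apply: (leq_trans (min_assignment_le _ s)); rewrite leqn0 sum_nat_eq0.
apply/forallP => i; rewrite /cell_count cards_eq0; apply/eqP/finset.setP => t.
rewrite !inE; apply/negP => /eqP ft; move: (sf i); rewrite -ft.
by rewrite codom_f.
Qed.

(** * Asymptotics *)

Section Asymptotics.
Context {R : realType}.
Implicit Types (p eps : R) (n m : nat).

(** The inverse of [1 - p] is [1 + p / (1 - p)], at most [expR (p / (1 - p))]. *)
Lemma expRN_le_1B p : p < 1 -> expR (- (p / (1 - p))) <= 1 - p.
Proof.
move=> p1; have p1' : 0 < 1 - p by rewrite subr_gt0.
rewrite expRN -[leRHS]invrK lef_pV2 ?posrE ?invr_gt0 ?expR_gt0 //.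
suff {1}-> : (1 - p)^-1 = 1 + p / (1 - p) by exact: expR_ge1Dx.
by field; rewrite gt_eqF.
Qed.

(** The expected number of empty cells in a row is at least a power of [n]. Each
cell is empty with probability about [expR (- m p)], which is at least
[n ^ (2 eps - 1)]; one [eps] is given up for the error of the
exponential approximation. *)
Lemma expected_empty_row_ge eps n m : (1 < n)%N -> 0 < eps < 1 ->
  (n * n)%:R^-1 <= eps -> m%:R * (n * n)%:R^-1 <= (1 - eps *+ 2) * ln n%:R ->
  expR (eps * ln n%:R) <= n%:R * (1 - (n * n)%:R^-1) ^+ m.
Proof.
move=> n1 /andP[e0 e1]; set p := _^-1; set L := ln _ => pe mp.
have n0 : (0 : R) < n%:R by rewrite ltr0n ltnW.
have L0 : 0 < L by rewrite ln_gt0 // ltr1n.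
have p1 : p < 1 by exact: le_lt_trans e1.
have p1' : 0 < 1 - p by rewrite subr_gt0.
have pm : expR (- ((1 - eps) * L)) <= (1 - p) ^+ m.
  apply: (@le_trans _ _ (expR (- (p / (1 - p))) ^+ m)); last first.
    by rewrite lerXn2r ?nnegrE ?expR_ge0 ?(ltW p1') // expRN_le_1B.
  rewrite -expRM_natl ler_expR mulrN lerN2 mulrA ler_pdivrMr //.
  apply: (le_trans mp); rewrite mulrAC ler_wpM2r ?(ltW L0) //.
  by rewrite mulr2n; nra.
rewrite -[n%:R]lnK ?posrE // -/L.
have -> : eps * L = L + - ((1 - eps) * L) by ring.
by rewrite expRD ler_wpM2l // expR_ge0.
Qed.

(** With [q] the probability that a cell is empty, take [x = expR (- q / 4)], so
that [x ^+ 4] dominates [1 - q]. Since [n q] is at least [expR (eps L)], where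
[L = ln n], it exceeds [8 L] as soon as [L >= 16 / eps ^ 2]; then [x ^+ n]
is at most [n ^ (-2)], and the [n + n] factors of the union bound multiply up
to at most [expR (2 / n)]. *)
Lemma no_matching_le eps n m : (1 < n)%N -> 0 < eps < 1 ->
  eps^-1 <= n%:R -> 16 / eps ^+ 2 <= ln n%:R ->
  m%:R * n%:R ^- 2 <= (1 - eps *+ 2) * ln n%:R ->
  #|[set f : {ffun 'I_m -> 'I_n * 'I_n} |
      ~~ [exists s : 'S_n, forall i, (i, s i) \notin codom f]]%SET|%:R <=
    ((n * n) ^ m)%:R * ((expR (2 / n%:R) - 1) *+ 2) :> R.
Proof.
move=> n1 e01 en eL mp; have /andP[e0 e1] := e01.
have n0 : (0 : R) < n%:R by rewrite ltr0n ltnW.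
have n2 : n%:R ^- 2 = (n * n)%:R^-1 :> R by rewrite natrM expr2.
set q : R := (1 - (n * n)%:R^-1) ^+ m.
have nq : expR (eps * ln n%:R) <= n%:R * q.
  apply: expected_empty_row_ge => //; last by rewrite -n2.
  rewrite -[eps]invrK lef_pV2 ?posrE ?invr_gt0 ?ltr0n ?muln_gt0 ?(ltnW n1) //.
  by rewrite (le_trans en) // ler_nat leq_pmulr // ltnW.
have q0 : 0 <= q.
  by have := le_trans (expR_ge0 _) nq; rewrite pmulr_rge0.
pose x := expR (- (q / 4)).
have x01 : 0 <= x <= 1 by rewrite expR_ge0 expR_le1 oppr_le0 divr_ge0.
have x4 : 1 - q <= x ^+ 4.
  rewrite /x -expRM_natl; apply: (le_trans (expR_ge1Dx _)).
  by rewrite ler_expR; lra.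
have := card_no_matching_le (ltnW n1) x01 x4; move=> /le_trans; apply.
rewrite ler_wpM2l // lerMn2r /= lerB //.
have xn : x ^+ n <= n%:R ^- 2.
  set L := ln _ in eL nq mp.
  have -> : n%:R ^- 2 = expR (- (2 * L)) :> R.
    by rewrite expRN expRM_natl /L lnK ?posrE.
  rewrite -expRM_natl ler_expR mulrN lerN2 mulrA ler_pdivlMr //.
  (* The quadratic term of the exponential series beats [8 L]. *)
  apply: le_trans nq; apply: le_trans (expR_ge1Dxn 1 _); last first.
    by rewrite mulr_ge0 ?(ltW e0) // ln_ge0 // ler1n ltnW.
  have : 16 <= eps ^+ 2 * L by rewrite mulrC -ler_pdivrMr // exprn_gt0.
  have : 0 < L by rewrite ln_gt0 // ltr1n.
  rewrite exprMn (_ : 2`!%:R = 2 :> R) //; nra.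
apply: (@le_trans _ _ (expR (x ^+ n) ^+ (n + n))).
  rewrite lerXn2r ?nnegrE ?addr_ge0 ?expR_ge0 ?expR_ge1Dx //.
  by rewrite exprn_ge0 //; case/andP: x01.
rewrite -expRM_natl ler_expR natrD.
rewrite (_ : 2 / _ = (n%:R + n%:R) * n%:R ^- 2); last by field; rewrite gt_eqF.
by rewrite ler_wpM2l // addr_ge0 // ltW.
Qed.

End Asymptotics.

Theorem theorem3 (R : realType) (c : R) (hc : c < 1)
  (m : nat -> nat) (hm : forall n : nat, (2 <= n)%N -> (0 < m n)%N)
  (d : nat -> measure_display) (T : forall n : nat, measurableType (d n))
  (P : forall n : nat, probability (T n) R)
  (X : forall n : nat, 'I_n * 'I_n -> {RV (P n) >-> nat})
  (hX : forall n : nat, (2 <= n)%N -> has_multinomial_law (X n) (m n))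
  (hlim : (limn_esup (fun n : nat =>
             ((m n)%:R * (n%:R ^- 2) / ln (n%:R : R))%:E) <= c%:E)%E) :
  (fun n : nat => P n [set w : T n |
     min_assignment (fun i j : 'I_n => X n (i, j) w) = 0%N])
    @ \oo --> (1%:E : \bar R).
Proof.
(* [1 - 2 eps] has to lie strictly between [c] and 1; the minimum keeps [eps]
   below 1 when [c] is very negative. *)
pose eps : R := Num.min (1 - c) 1 / 4.
have e0 : 0 < eps by rewrite divr_gt0 // lt_min subr_gt0 hc ltr01.
have e1 : eps < 1.
  by rewrite ltr_pdivrMr// mul1r gt_min; apply/orP; right; lra.
have ce : c < 1 - eps *+ 2.
  have : eps * 4 <= 1 - c by rewrite divfK// ge_min lexx.
  rewrite mulr2n; lra.
have mnear : \forall n \near \oo, (m n)%:R * n%:R ^- 2 / ln n%:R < 1 - eps *+ 2.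
  have /ereal_inf_lt : (limn_esup (fun n : nat =>
      ((m n)%:R * (n%:R ^- 2) / ln (n%:R : R))%:E) < (1 - eps *+ 2)%:E)%E.
    by rewrite (le_lt_trans hlim)// lte_fin.
  move=> [_ [V Voo <-] supV]; apply: filterS Voo => n Vn.
  rewrite -lte_fin (le_lt_trans _ supV)//; apply: ereal_sup_ubound.
  by exists n.
apply: (@squeeze_cvge _ _ _ _
  (fun n => (1 - (expR (2 / n%:R) - 1) *+ 2)%:E) _ (fun=> 1%E)).
- near=> n.
  have n1 : (1 < n)%N by near: n; exact: nbhs_infty_gt.
  have n0 : 0 < n%:R :> R by rewrite ltr0n ltnW.
  have L0 : 0 < ln n%:R :> R by rewrite ln_gt0// ltr1n.
  pose Q (k : 'I_n * 'I_n -> nat) := min_assignment (fun i j => k (i, j)) == 0%N.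
  have -> : [set w | min_assignment (fun i j : 'I_n => X n (i, j) w) = 0%N] =
      [set w | Q (fun x => X n x w)] by apply/seteqP; split => w /= /eqP.
  rewrite probability_le1 ?andbT; last exact: (measurable_RVs (X n) Q).
  apply: (le_trans _ (le_law_count Q (hX n n1))); rewrite lee_fin.
  have card2 : #|{: 'I_n * 'I_n}| = (n * n)%N by rewrite card_prod card_ord.
  have N0 : 0 < (#|{: 'I_n * 'I_n}| ^ m n)%:R :> R.
    by rewrite ltr0n expn_gt0 card2 muln_gt0 (ltnW n1).
  rewrite ler_pdivlMr// mulrBl mul1r lerBlDr.
  have e01 : 0 < eps < 1 by rewrite e0.
  have mn : (m n)%:R * n%:R ^- 2 <= (1 - eps *+ 2) * ln n%:R.
    rewrite -ler_pdivrMr// ltW//; near: n; exact: mnear.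
  have en : eps^-1 <= n%:R by near: n; exact: nbhs_infty_ger.
  have eL : 16 / eps ^+ 2 <= ln n%:R.
    rewrite -ler_expR lnK ?posrE//; near: n; exact: nbhs_infty_ger.
  have := no_matching_le n1 e01 en eL mn.
  rewrite -card2 [leRHS]mulrC => bound; apply: le_trans (lerD (lexx _) bound).
  rewrite -natrD ler_nat -[X in (_ ^ X)%N]card_ord -card_ffun.
  rewrite -(cardsC [set f : {ffun 'I_(m n) -> 'I_n * 'I_n} | Q (cell_count f)]%SET).
  rewrite leq_add2l; apply/subset_leq_card/fintype.subsetP => f; rewrite !inE.
  by apply: contra => /min_assignment_eq0/eqP.
- have : 1 - (expR (2 / n%:R) - 1) *+ 2 @[n --> \oo] --> (1 - (expR 0 - 1) *+ 2 : R).
    have h : (2 / n%:R : R) @[n --> \oo] --> (0 : R).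
      rewrite -(mulr0 2); apply: cvgM; first exact: cvg_cst.
      apply/gtr0_cvgV0; last exact: cvgr_idn.
      by near=> n; rewrite ltr0n; near: n; exact: nbhs_infty_gt.
    have h' : expR (2 / n%:R) @[n --> \oo] --> (expR 0 : R).
      by apply: continuous_cvg => //; exact: continuous_expR.
    have h2 : expR (2 / n%:R) - 1 @[n --> \oo] --> (expR 0 - 1 : R).
      by apply: cvgB h' _; exact: cvg_cst.
    rewrite mulr2n; under eq_fun do rewrite mulr2n.
    by apply: cvgB; [exact: cvg_cst|exact: cvgD].
  rewrite expR0 subrr mul0rn subr0 => h.
  by apply: cvg_EFin => //; near=> n.
- exact: cvg_cst.
Unshelve. all: by end_near.
Qed.
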